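(* Let $n,k,d$ be positive integers with $k\le d<n$, let $\alpha>0$, and let $l$ be an integer with $1\le l\le\left\lfloor\frac{n}{n+1-k}\right\rfloor$. Put $$k_1=\left\lfloor\frac{n}{l}\right\rfloor-n+k,\quad d_1=\left\lfloor\frac{n}{l}\right\rfloor-n+d,\quad k_l=k-(l-1)\left\lfloor\frac{n}{l}\right\rfloor,\quad d_l=d-(l-1)\left\lfloor\frac{n}{l}\right\rfloor.$$ Then $$C^{\mathrm{exact}}_{n,k,d}\left(\alpha,\frac{d_1\alpha}{d-k+1}\right)\ \ge\ \left((l-1)k_1+\frac{k_l d_1}{d_l}\right)\alpha.$$
   Context: A distributed storage system (DSS) with parameters $(n,k,d)$ stores a file across $n$ nodes, each storing an amount $\alpha$ of information (e.g. $\alpha$ symbols over a finite field, where symbols may be split into arbitrarily many sub-symbols), such that the file can be reconstructed from the contents of any $k$ nodes, and any lost node can be repaired by contacting any $d$ of the remaining nodes, each of which transmits an amount $\beta$ to the replacement node, for a total repair bandwidth $\gamma=d\beta$. Repair is exact: the replacement node stores exactly the same content as the lost node. $C^{\mathrm{exact}}_{n,k,d}(\alpha,\gamma)$ denotes the maximum size of a file that can be stored by such an exact-repair DSS with $n$ nodes, node size (at most) $\alpha$ and total repair bandwidth $\gamma$. *)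

(* Defs.v *)
From HB Require Import structures.
From mathcomp Require Import all_boot all_order all_algebra.
From mathcomp Require Import all_classical all_reals all_analysis.
Set Implicit Arguments. Unset Strict Implicit. Unset Printing Implicit Defensive.
Import Order.TTheory GRing.Theory Num.Theory.
Local Open Scope classical_set_scope.
Local Open Scope ring_scope.

(* An exact-repair (n,k,d) distributed storage code.
   - M : the finite set of possible files;
   - S : the node alphabet (content of one node);
   - T : the alphabet of a single helper transmission;
   - store i m : content of node i when the file is m.
   Reconstruction: the contents of any k nodes determine the file.
   Exact repair: for any failed node i and any set H of d other nodes,
   each helper j in H sends enc j (its content) (enc may depend on i, H),
   and from these d messages the replacement node computes exactly store i m. *)
Definition exact_dss (n k d : nat) (M S T : finType) (store : 'I_n -> M -> S) : Prop :=
  (forall K : {set 'I_n}, #|K| = k ->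
     forall m m' : M, (forall j, j \in K -> store j m = store j m') -> m = m')
  /\
  (forall (i : 'I_n) (H : {set 'I_n}), #|H| = d -> i \notin H ->
     exists (enc : 'I_n -> S -> T) (dec : {ffun 'I_n -> option T} -> S),
       forall m : M,
         dec [ffun j => if j \in H then Some (enc j (store j m)) else None]
         = store i m).

(* File size B is achievable with node size alpha and total repair bandwidth gamma
   (per-helper bandwidth beta = gamma / d), all measured in a common unit of
   s nats (s > 0 arbitrary, which accounts for splitting symbols into
   arbitrarily many sub-symbols). *)
Definition achievable {R : realType} (n k d : nat) (alpha gamma B : R) : Prop :=
  exists (M S T : finType) (store : 'I_n -> M -> S) (s : R),
    0 < s /\ @exact_dss n k d M S T store /\
    s * B <= ln (#|M|%:R) /\
    ln (#|S|%:R) <= s * alpha /\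
    ln (#|T|%:R) <= s * (gamma / d%:R).

Definition C_exact {R : realType} (n k d : nat) (alpha gamma : R) : \bar R :=
  ereal_sup ((fun B : R => B%:E) @` [set B | achievable n k d alpha gamma B]).

(* Main.v *)
Require Import Defs.
From HB Require Import structures.
From mathcomp Require Import all_boot all_order all_algebra all_fingroup.
From mathcomp Require Import all_classical all_reals all_analysis.
From mathcomp Require Import zify ring.
Import Order.TTheory GRing.Theory Num.Theory.
Local Open Scope ring_scope.

(** Put m = n / l and split the nodes into l - 1 groups of size m and one group
    of the remaining n - (l - 1) m >= m nodes. On a group of size g use a code
    with n - k parity checks in which g + d - n helpers repair a node, each
    sending a fraction 1 / (d - k + 1) of its content; at least that many of any
    d helpers lie in the group. Taking d_l copies of the code on each small group
    and d_1 copies on the last one makes the total repair bandwidth the same for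
    all nodes. Concatenating this over all permutations of the nodes makes all d
    helpers send the same amount.

    The code on a group is that of Ye and Barg: with s = d - k + 1, a node i holds
    symbols c_(i,a), a in [s]^n, subject for each a to the checks
    sum_i lam(i, a_i)^t c_(i,a) = 0, t < n - k, with all lam(i, u) distinct.
    Summing the checks over the i-th coordinate of a leaves a system whose
    unknowns are the s symbols c_(i,a(i,u)) of the failed node and one sum
    sum_u c_(j,a(i,u)) for every other node j; helper j sends exactly this sum. *)

(** * Vandermonde systems and the repair of a single node *)

(** Combining the moments with the coefficients of a polynomial of degree below [r] that vanishes at
    every [p j] with [j] in [P] and [j != i] isolates [x i]. *)
Lemma moments_eq0 (F : fieldType) (I : finType) (P : {set I}) (p x : I -> F)
    (r : nat) :
  {in P &, injective p} -> (#|P| <= r)%N -> (forall i, i \notin P -> x i = 0) ->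
  (forall t, (t < r)%N -> \sum_i p i ^+ t * x i = 0) -> forall i, x i = 0.
Proof.
move=> p_inj leP x0 mom i; have [iP|/x0//] := boolP (i \in P).
pose f : {poly F} := \prod_(z <- [seq p j | j <- enum (P :\ i)]) ('X - z%:P).
have szf : (size f <= r)%N.
  rewrite size_prod_XsubC size_map -cardE.
  by move: leP; rewrite (cardsD1 i P) iP add1n.
have fj j : j \in P -> j != i -> f.[p j] = 0.
  move=> jP ji; apply/eqP; rewrite -rootE root_prod_XsubC; apply: map_f.
  by rewrite mem_enum !inE ji jP.
have fi : f.[p i] != 0.
  rewrite -rootE root_prod_XsubC; apply/mapP => -[j].
  rewrite mem_enum !inE => /andP[ji jP] /p_inj E.
  by rewrite E ?eqxx in ji.
have: \sum_j f.[p j] * x j = 0.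
  under eq_bigr => j _ do rewrite (horner_coef_wide _ szf) big_distrl /=.
  rewrite exchange_big /= big1// => t _.
  under eq_bigr => j _ do rewrite -mulrA.
  by rewrite -big_distrr /= mom ?mulr0.
rewrite (bigD1 i)//= big1 ?addr0 => [|j ji].
  by move/eqP; rewrite mulf_eq0 (negbTE fi) => /eqP.
by have [jP|/x0->] := boolP (j \in P); [rewrite fj ?mul0r|rewrite mulr0].
Qed.

Definition update {n s : nat} (a : {ffun 'I_n -> 'I_s}) (i : 'I_n) (u : 'I_s) :
  {ffun 'I_n -> 'I_s} := [ffun j => if j == i then u else a j].

Lemma update_update (n s : nat) (a : {ffun 'I_n -> 'I_s}) i u v :
  update (update a i u) i v = update a i v.
Proof. by apply/ffunP => j; rewrite !ffunE; case: eqP. Qed.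

Lemma update_id (n s : nat) (a : {ffun 'I_n -> 'I_s}) i :
  update a i (a i) = a.
Proof. by apply/ffunP => j; rewrite !ffunE; case: eqP => // ->. Qed.

(** Summed over the [i]-th coordinate, the checks form a Vandermonde system with at most
    [s + (#|G| - #|D| - 1) <= r] unknowns: the [s] symbols of node [i] and one line sum for each
    other node of [G] outside [D]. *)
Lemma repair_eq0 (F : fieldType) (n s r : nat) (lam : 'I_n * 'I_s -> F)
    (x : {ffun 'I_n -> 'I_s} -> 'I_n -> F) (G D : {set 'I_n}) (i : 'I_n) :
  injective lam -> i \in G -> i \notin D -> D \subset G ->
  (s + #|G| <= r + #|D| + 1)%N ->
  (forall a j, j \notin G -> x a j = 0) ->
  (forall (a : {ffun _ -> _}) t, (t < r)%N -> \sum_j lam (j, a j) ^+ t * x a j = 0) ->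
  (forall a j, j \in D -> \sum_u x (update a i u) j = 0) ->
  forall a, x a i = 0.
Proof.
move=> lam_inj iG iD DG card_le xG par sumD a.
(* For [j != i] the point [lam (j, a j)] is constant along the line, so the whole line sum of node
   [j] can be placed at the single index [(j, a j)]. *)
pose y (z : 'I_n * 'I_s) : F :=
  if z.1 == i then x (update a i z.2) i
  else if z.2 == a z.1 then \sum_u x (update a i u) z.1 else 0.
pose P : {set 'I_n * 'I_s} := [set (i, u) | u : 'I_s] :|:
  [set (j, a j) | j in (G :\: D) :\ i].
suff /(_ (i, a i)): forall z, y z = 0 by rewrite /y /= eqxx update_id.
apply: (@moments_eq0 _ _ P lam y r).
- by move=> z z' _ _ /lam_inj.
- apply: leq_trans (leq_card_setU _ _) _.
  have h1 : (#|[set (i, u) | u : 'I_s]| <= s)%N.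
    by rewrite (leq_trans (leq_imset_card _ _))// card_ord.
  have h2 : (#|[set (j, a j) | j in (G :\: D) :\ i]| <= #|(G :\: D) :\ i|)%N.
    exact: leq_imset_card.
  apply: leq_trans (leq_add h1 h2) _.
  have := cardsD1 i (G :\: D); rewrite !inE iG iD /= => e.
  have := cardsID D G; rewrite (finset.setIidPr DG).
  move: e card_le; move: #|_ :\ i| #|_ :\: _| => *; lia.
- move=> [j u]; rewrite !inE negb_or /y /= => /andP[/imsetP Hi /imsetP Hj].
  case: eqP => [ji|/eqP ji]; first by case: Hi; exists u; rewrite ?ji.
  case: eqP => // ua; have [jD|jD] := boolP (j \in D); first exact: sumD.
  rewrite big1// => v _; apply: xG; apply/negP => jG.
  by case: Hj; exists j; rewrite ?ua// !inE ji jD jG.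
- move=> t tr.
  transitivity (\sum_j \sum_u lam (j, u) ^+ t * y (j, u)).
    by rewrite pair_big; apply: eq_bigr => -[].
  transitivity (\sum_j \sum_u (lam (j, update a i u j) ^+ t *
      x (update a i u) j)).
    apply: eq_bigr => j _; rewrite /y /=; case: eqP => [->|/eqP ji].
      by apply: eq_bigr => u _; rewrite ffunE eqxx.
    rewrite (bigD1 (a j))//= eqxx [X in _ + X]big1 ?addr0 => [|u ua]; last first.
      by rewrite (negbTE ua) mulr0.
    by rewrite big_distrr; apply: eq_bigr => u _; rewrite ffunE (negbTE ji).
  by rewrite exchange_big big1// => u _; apply: par.
Qed.

(** * Alphabets, counting and decoding *)

(** Contents and messages are handled as functions with known support on a large index set; [e]
    packs them into an alphabet of the required size and [g] unpacks them. *)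
Lemma pred_retract (U S : finType) (A : {pred U}) (u0 : U) (s0 : S) :
  (#|A| <= #|S|)%N ->
  exists (e : U -> S) (g : S -> U), {in A, cancel e g}.
Proof.
move=> le; exists (fun u => nth s0 (enum S) (index u (enum A))).
exists (fun z => nth u0 (enum A) (index z (enum S))) => u uA.
have lt : (index u (enum A) < size (enum A))%N by rewrite index_mem mem_enum.
rewrite index_uniq ?enum_uniq ?nth_index ?mem_enum//.
by apply: leq_trans lt _; rewrite -!cardE.
Qed.

Lemma pigeonhole_fibre (U Y : finType) (f : U -> Y) (V : {set U}) (y0 : Y) :
  exists y, (#|V| <= #|Y| * #|[set u in V | f u == y]|)%N.
Proof.
pose N y := #|[set u in V | f u == y]|.
exists [arg max_(y > y0) N y]; case: arg_maxnP => // y _ maxy.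
rewrite -sum1_card (partition_big f predT)//= -sum_nat_const.
apply: leq_sum => z _; apply: leq_trans (maxy z isT).
by rewrite /N -sum1_card; apply: eq_leq; apply: eq_bigl => u; rewrite !inE.
Qed.

Lemma card_supported (X : finType) (F : finFieldType) (D : {pred X}) :
  #|[set f : {ffun X -> F} | [forall x, (x \in D) || (f x == 0)]]|
    = (#|F| ^ #|D|)%N.
Proof.
rewrite -(card_pffun_on 0 D F); apply: eq_card => f; rewrite inE.
apply/idP/pffun_onP => [/forallP h|[/supportP h _]].
  split=> [|? _]; last by [].
  by apply/supportP => x xD; have := h x; rewrite (negbTE xD) => /eqP.
by apply/forallP => x; have [//|xD] := boolP (x \in D); rewrite h ?eqxx.
Qed.

(** The decoder takes any file that agrees with the received messages; [s0] is returned only for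
    messages that arise from no file. *)
Lemma exact_dss_of_determined (n k d : nat) (M S T : finType) (s0 : S)
    (store : 'I_n -> M -> S) :
  (forall K : {set 'I_n}, #|K| = k -> forall m m',
     (forall j, j \in K -> store j m = store j m') -> m = m') ->
  (forall (i : 'I_n) (H : {set 'I_n}), #|H| = d -> i \notin H ->
     exists enc : 'I_n -> S -> T, forall m m',
       (forall j, j \in H -> enc j (store j m) = enc j (store j m')) ->
       store i m = store i m') ->
  exact_dss k d T store.
Proof.
move=> rec rep; split=> // i H cH iH; have [enc encP] := rep i H cH iH.
pose msg m : {ffun 'I_n -> option T} :=
  [ffun j => if j \in H then Some (enc j (store j m)) else None].
exists enc, (fun z => if [pick m | msg m == z] is Some m then store i m else s0).
move=> m; case: pickP => [m' /eqP/ffunP E|/(_ m)]; last by rewrite eqxx.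
by apply: encP => j jH; have := E j; rewrite !ffunE jH => -[].
Qed.

Lemma exists_field_injection (X : finType) :
  exists (F : finFieldType) (f : X -> F), injective f.
Proof.
have [p ltp pr] := prime_above #|X|.
have le : (#|X| <= #|'F_p|)%N by rewrite card_Fp// ltnW.
exists 'F_p, (fun x => enum_val (widen_ord le (enum_rank x))) => x y.
by move=> /enum_val_inj /(congr1 val) /= /ord_inj /enum_rank_inj.
Qed.

(** Each line in direction [i] has one point with [a i = ord0], so this is the number of line sums
    that a helper sends per block. *)
Lemma card_ffun_fixed (n s : nat) (i : 'I_n) :
  #|[set a : {ffun 'I_n -> 'I_s.+1} | a i == ord0]| = (s.+1 ^ n.-1)%N.
Proof.
pose Q (j : 'I_n) : pred 'I_s.+1 := if j == i then pred1 ord0 else predT.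
have -> : #|[set a : {ffun 'I_n -> 'I_s.+1} | a i == ord0]| = #|family Q|.
  apply: eq_card => a; rewrite inE; apply/idP/familyP => [ai j|/(_ i)].
    by rewrite /Q; case: eqP => [->|].
  by rewrite /Q eqxx.
rewrite card_family foldrE big_map big_enum/= (bigD1 i)//= /Q eqxx card1 mul1n.
rewrite (eq_bigr (fun=> s.+1)) => [|j /negbTE->]; last by rewrite card_ord.
by rewrite prod_nat_const cardC1 card_ord.
Qed.

(** * The storage code built from blocks *)

(* The blocks [b] carry independent copies of the code, on the node sets [G b];
   [cS] bounds the number of blocks at a node and [cT] the number of blocks for
   which a given helper is asked to transmit. The files are the words of a largest
   fibre of the syndrome map rather than its kernel, so that the pigeonhole
   principle gives their number. *)
Lemma block_dss (n k d cS cT : nat) (B : finType) (G : B -> {set 'I_n}) :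
  (k <= d)%N -> (d < n)%N ->
  (forall i, (#|[set b | i \in G b]| <= cS)%N) ->
  (forall i (H : {set 'I_n}), #|H| = d -> i \notin H ->
    exists D : B -> {set 'I_n}, [/\ forall b, D b \subset H,
      forall b, D b \subset G b,
      forall b, i \in G b -> (#|G b| + d <= #|D b| + n)%N &
      forall j, j \in H ->
        (#|[set b | (i \in G b) && (j \in D b)]| <= cT)%N]) ->
  let s := (d - k).+1 in
  exists (q : nat) (M S T : finType) (store : 'I_n -> M -> S),
    [/\ (1 < q)%N, exact_dss k d T store,
        (q ^ (s ^ n * \sum_b #|G b|)
           <= #|M| * q ^ (s ^ n * (#|B| * (n - k))))%N,
        #|S| = (q ^ (s ^ n * cS))%N & #|T| = (q ^ (s ^ n.-1 * cT))%N].
Proof.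
move=> kd dn leS helpers s.
have [F [lam lam_inj]] := exists_field_injection ('I_n * 'I_s)%type.
have q_gt1 : (1 < #|F|)%N by exact: card_finNzRing_gt1.
pose A := {ffun 'I_n -> 'I_s}.
have cA : #|{: A}| = (s ^ n)%N by rewrite card_ffun !card_ord.
pose r := (n - k)%N.
pose word := {ffun B * A * 'I_n -> F}.
pose V : {set word} := [set c : word |
  [forall x, (x \in [pred x : B * A * 'I_n | x.2 \in G x.1.1]) || (c x == 0)]].
pose synd (c : word) : {ffun B * A * 'I_r -> F} :=
  [ffun x : B * A * 'I_r => \sum_i lam (i, x.1.2 i) ^+ x.2 * c (x.1, i)].
have [y My] := @pigeonhole_fibre _ _ synd V [ffun=> 0].
pose M : finType := {c : word | c \in [set c : word in V | synd c == y]}.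
pose S : finType := {ffun 'I_(s ^ n * cS) -> F}.
pose T : finType := {ffun 'I_(s ^ n.-1 * cT) -> F}.
pose U := {ffun B * A -> F}.
pose US (P : {pred B * A}) : {pred U} :=
  [set f : U | [forall x, (x \in P) || (f x == 0)]].
pose raw (i : 'I_n) (m : M) : U := [ffun x : B * A => val m (x, i)].
pose PS i : {pred B * A} := finset.setX [set b | i \in G b] finset.setT.
have /choice[e /choice[g egK]] (i : 'I_n) : exists (e : U -> S) (g : S -> U),
    {in US (PS i), cancel e g}.
  apply: pred_retract; [exact: [ffun=> 0]|exact: [ffun=> 0]|].
  rewrite /US cardE -cardE card_supported card_ffun card_ord cardsX cardsT cA.
  by rewrite leq_exp2l ?q_gt1// mulnC leq_mul2l leS orbT.
have codeword (m : M) : (val m \in V) /\ (synd (val m) = y).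
  by have := valP m; rewrite inE => /andP[mV /eqP].
have val0 (m : M) b a i : i \notin G b -> val m (b, a, i) = 0.
  move=> iG; have [+ _] := codeword m; rewrite inE => /forallP/(_ (b, a, i)).
  by rewrite inE /= (negbTE iG) => /eqP.
have rawS i m : raw i m \in US (PS i).
  rewrite inE; apply/forallP => -[b a]; rewrite !inE ffunE andbT.
  by have [//|iG] := boolP (i \in G b); rewrite val0 ?eqxx.
(* The common syndrome [y] need not be zero, so the homogeneous checks hold for differences of
   files. *)
have par (m m' : M) b (a : A) t : (t < r)%N ->
    \sum_i lam (i, a i) ^+ t * (val m (b, a, i) - val m' (b, a, i)) = 0.
  move=> tr.
  have /ffunP/(_ (b, a, Ordinal tr)) :=
    etrans (codeword m).2 (esym (codeword m').2).
  rewrite !ffunE /= => /eqP; rewrite -subr_eq0 -sumrB => /eqP E; rewrite -[RHS]E.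
  by apply: eq_bigr => i _; rewrite mulrBr.
exists #|F|, M, S, T, (fun i m => e i (raw i m)); split.
- exact: q_gt1.
- apply: exact_dss_of_determined; first exact: [ffun=> 0].
    (* The difference of the two files vanishes on [K]; for each [b] and [a] this leaves at most
       [n - k] unknowns, as many as there are checks. *)
    move=> K cK m m' eqK; apply: val_inj; apply/ffunP => -[[b a] i].
    apply/eqP; rewrite -subr_eq0; apply/eqP; move: i.
    apply: (@moments_eq0 _ _ (~: K) (fun i => lam (i, a i)) _ r).
    + by move=> i j _ _ /lam_inj[].
    + by rewrite cardsCs finset.setCK card_ord cK.
    + move=> j; rewrite inE negbK => /eqK /(congr1 (g j)).
      rewrite !egK// => /ffunP/(_ (b, a)).
      by rewrite !ffunE => ->; rewrite subrr.
    + exact: par.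
  move=> i H cH iH; have [D [DH DG leD loadD]] := helpers i H cH iH.
  (* A line in direction [i] is represented by its point with [i]-th coordinate [ord0], where the
     sum along the line is recorded. *)
  pose msg (j : 'I_n) (u : U) : U := [ffun x : B * A =>
    if [&& i \in G x.1, j \in D x.1 & x.2 i == ord0]
    then \sum_v u (x.1, update x.2 i v) else 0].
  pose PT j : {pred B * A} := finset.setX
    [set b | (i \in G b) && (j \in D b)] [set a : A | a i == ord0].
  have /choice[eT /choice[gT eTK]] (j : 'I_n) :
      exists (e : U -> T) (g : T -> U), j \in H -> {in US (PT j), cancel e g}.
    have [jH|] := boolP (j \in H); last first.
      by move=> _; exists (fun=> [ffun=> 0]), (fun=> [ffun=> 0]).
    have [|e' [g' e'K]] := @pred_retract U T (US (PT j)) [ffun=> 0] [ffun=> 0].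
      rewrite /US cardE -cardE card_supported card_ffun card_ord cardsX.
      rewrite card_ffun_fixed leq_exp2l// mulnC.
      by rewrite leq_mul2l loadD ?orbT.
    by exists e', g'.
  have msgT j u : msg j u \in US (PT j).
    rewrite inE; apply/forallP => -[b a]; rewrite !inE ffunE /= -andbA.
    by case: ifP; rewrite ?eqxx.
  exists (fun j z => eT j (msg j (g j z))) => m m' eqH.
  congr (e i _); apply/ffunP => -[b a]; rewrite !ffunE.
  have [iG|iG] := boolP (i \in G b); last by rewrite !val0.
  apply/eqP; rewrite -subr_eq0; apply/eqP.
  pose x (a' : A) j := val m (b, a', j) - val m' (b, a', j).
  apply: (@repair_eq0 F n s r lam x (G b) (D b) i) => //.
  + by apply: contra iH; apply: (fintype.subsetP (DH b)).
  + by have := leD b iG; rewrite /s /r; lia.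
  + by move=> a' j jG; rewrite /x !val0// subrr.
  + by move=> a' t; apply: par.
  + move=> a' j jD; have jH := fintype.subsetP (DH b) _ jD.
    have /(congr1 (gT j)) := eqH j jH.
    rewrite !eTK// !egK// => /ffunP/(_ (b, update a' i ord0)).
    rewrite !ffunE /= iG jD !eqxx /=.
    under eq_bigr => v _ do rewrite update_update ffunE.
    under [in X in _ = X -> _]eq_bigr => v _ do rewrite update_update ffunE.
    by move=> /eqP; rewrite -subr_eq0 -sumrB => /eqP.
- have -> : #|{: M}| = #|[set c : word in V | synd c == y]| by rewrite card_sig.
  move: My; rewrite card_ffun !card_prod card_ord cA mulnC.
  rewrite (_ : #|V| = #|F| ^ (s ^ n * \sum_b #|G b|))%N; last first.
    rewrite card_supported; congr (_ ^ _)%N.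
    rewrite -sum1_card -cA big_distrr /=.
    transitivity (\sum_(p : B * A) \sum_(i in G p.1) 1)%N.
      by rewrite pair_big_dep; apply: eq_bigl => -[].
    transitivity (\sum_b \sum_(a : A) #|G b|)%N.
      by rewrite pair_big; apply: eq_bigr => p _; rewrite sum1_card.
    by apply: eq_bigr => b _; rewrite sum_nat_const.
  by rewrite [(#|B| * _)%N]mulnC -mulnA.
- by rewrite card_ffun card_ord.
- by rewrite card_ffun card_ord.
Qed.

(** * Balancing the load of the helpers over all permutations *)

(** For each permutation the helpers are chosen in the image of [H] and pulled back, so by symmetry
    all nodes of [H] carry the same load. Each permutation adds [w] to the total load, so each
    helper carries [n! * w / d]. *)
Lemma balanced_helpers (n d w : nat) (C : finType) (G : C -> {set 'I_n}) :
  (0 < d)%N ->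
  (forall p, \sum_(c | p \in G c) (#|G c| + d - n) = w)%N ->
  forall (i : 'I_n) (H : {set 'I_n}), #|H| = d -> i \notin H ->
  exists D : 'S_n * C -> {set 'I_n}, [/\ forall b, D b \subset H,
    forall b : 'S_n * C, D b \subset b.1 @^-1: G b.2,
    forall b : 'S_n * C, i \in b.1 @^-1: G b.2 ->
      (#|b.1 @^-1: G b.2| + d <= #|D b| + n)%N &
    forall j, j \in H ->
      (#|[set b : 'S_n * C | (i \in b.1 @^-1: G b.2) && (j \in D b)]|
         <= n`! * w %/ d)%N].
Proof.
move=> d_gt0 sumw i H cH iH.
(* The choice depends only on [c] and on [K], later the image of [H]; hence permutations of [H]
   merely permute the loads. *)
pose f (K : {set 'I_n}) c : {set 'I_n} :=
  [set x in take (#|G c| + d - n) (enum (K :&: G c))].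
have fS K c : f K c \subset K :&: G c.
  by apply/fintype.subsetP => x; rewrite inE => /mem_take; rewrite mem_enum.
have cf (K : {set 'I_n}) c : #|K| = d -> #|f K c| = (#|G c| + d - n)%N.
  move=> cK; rewrite cardsE (card_uniqP _) ?take_uniq ?enum_uniq//.
  rewrite size_takel// -cardE; have := cardsUI K (G c); rewrite cK.
  by have := max_card (K :|: G c); rewrite card_ord; lia.
pose D (b : 'S_n * C) := b.1 @^-1: f (b.1 @: H) b.2.
have DH b : D b \subset H.
  apply/fintype.subsetP => x; rewrite inE => /(fintype.subsetP (fS _ _)).
  by rewrite inE mem_imset => [/andP[]//|]; apply: perm_inj.
have DG (b : 'S_n * C) : D b \subset b.1 @^-1: G b.2.
  apply/fintype.subsetP => x; rewrite [in X in X -> _]inE [in X in _ -> X]inE => /(fintype.subsetP (fS _ _)).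
  by rewrite inE => /andP[].
have cD b : #|D b| = (#|G b.2| + d - n)%N.
  by rewrite card_preimset ?cf ?card_imset//; apply: perm_inj.
exists D; split => //.
  by move=> b _; rewrite cD card_preimset; [lia|apply: perm_inj].
pose L j : {set 'S_n * C} := [set b : 'S_n * C | (i \in b.1 @^-1: G b.2) && (j \in D b)].
have LE j j' : j \in H -> j' \in H -> #|L j| = #|L j'|.
  move=> jH j'H; pose t := tperm j j'.
  pose h (b : 'S_n * C) : 'S_n * C := ((t * b.1)%g, b.2).
  have hinj : injective h by move=> [b c] [b' c'] [/mulgI -> ->].
  (* Composing with [t], which fixes [i] and preserves [H], exchanges the loads. *)
  rewrite -(card_preimset (L j) hinj); apply: eq_card => -[b c].
  have ij (x : 'I_n) : x \in H -> x != i by apply: contraTneq => ->.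
  have tH : (t * b)%g @: H = b @: H.
    apply/eqP; rewrite eqEcard !card_imset ?leqnn ?andbT; try exact: perm_inj.
    apply/fintype.subsetP => _ /imsetP[x xH ->]; rewrite permM imset_f//.
    by rewrite /t; case: tpermP => // ->.
  by rewrite !inE /= tH !permM tpermL tpermD ?ij.
have sumL : (\sum_(j in H) #|L j| = n`! * w)%N.
  transitivity (\sum_(b : 'S_n * C | i \in b.1 @^-1: G b.2) #|D b|)%N.
    under eq_bigr => j _ do rewrite -sum1_card.
    rewrite (exchange_big_dep (fun b : 'S_n * C => i \in b.1 @^-1: G b.2))/=.
      apply: eq_bigr => b ib; rewrite -sum1_card; apply: eq_bigl => j.
      rewrite [b \in _]inE ib /=.
      by apply: andb_idl => jD; apply: (fintype.subsetP (DH b)).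
    by move=> j b _; rewrite inE => /andP[].
  rewrite (eq_bigl (fun b : 'S_n * C => xpredT b.1 && (b.1 i \in G b.2))); last first.
    by move=> b; rewrite inE.
  under eq_bigr => b _ do rewrite cD.
  rewrite -(pair_big_dep xpredT (fun (s : 'S_n) c => s i \in G c)
    (fun _ c => (#|G c| + d - n)%N)) /=.
  under eq_bigr => s _ do rewrite sumw.
  by rewrite sum_nat_const; congr (_ * _)%N; rewrite card_Sn.
move=> j jH; rewrite leq_divRL// -sumL.
rewrite (eq_bigr (fun=> #|L j|)) => [|j' j'H]; last exact: LE.
by rewrite sum_nat_const cH mulnC.
Qed.

(** * Grouping the nodes *)

Lemma card_ord_interval (n a b : nat) :
  (b <= n)%N -> #|[set p : 'I_n | (a <= p < b)%N]| = (b - a)%N.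
Proof.
move=> bn; rewrite -sum1_card.
under eq_bigl do rewrite inE.
rewrite -(big_mkord (fun p => a <= p < b)%N (fun=> 1%N)).
transitivity (\sum_(a <= p < b) 1)%N; last by rewrite sum_nat_const_nat muln1.
rewrite (big_nat_widen _ _ _ _ _ bn) (big_nat_widenl _ _ _ _ _ (leq0n a)).
by apply: eq_bigl => p /=; rewrite andbC.
Qed.

(** Here [l] counts only the small groups. Each has [dl] copies needing [d1] helpers, and the last
    group has [d1] copies needing [dl] helpers, so the product is the same at every node. *)
Lemma node_grouping (n d l m : nat) :
  (l * m + m <= n)%N -> (d < n)%N ->
  let d1 := (m + d - n)%N in
  let dl := (n - l * m + d - n)%N in
  exists (C : finType) (G : C -> {set 'I_n}),
    [/\ #|C| = (l * dl + d1)%N,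
        (\sum_c #|G c| = l * dl * m + d1 * (n - l * m))%N,
        forall c, (m <= #|G c|)%N &
        forall p, (\sum_(c | p \in G c) (#|G c| + d - n) = dl * d1)%N].
Proof.
move=> lmn dn d1 dl.
pose G (c : 'I_l * 'I_dl + 'I_d1) : {set 'I_n} :=
  match c with
  | inl x => [set p : 'I_n | (x.1 * m <= p < x.1 * m + m)%N]
  | inr _ => [set p : 'I_n | (l * m <= p < n)%N]
  end.
have cGl x : #|G (inl x)| = m.
  rewrite card_ord_interval; first by lia.
  have := ltn_ord x.1; have : (x.1.+1 * m <= l * m)%N by rewrite leq_mul2r ltn_ord orbT.
  by lia.
have cGr w : #|G (inr w)| = (n - l * m)%N by rewrite card_ord_interval.
exists ('I_l * 'I_dl + 'I_d1)%type, G; split.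
- by rewrite card_sum card_prod !card_ord.
- rewrite big_sumType /=; congr (_ + _)%N.
    rewrite (eq_bigr (fun=> m)) => [|x _]; last exact: cGl.
    by rewrite sum_nat_const card_prod !card_ord.
  rewrite (eq_bigr (fun=> (n - l * m)%N)) => [|x _]; last exact: cGr.
  by rewrite sum_nat_const card_ord.
- by move=> [x|w]; rewrite ?cGl// cGr; lia.
move=> p; rewrite big_sumType /=.
rewrite (eq_bigr (fun=> d1)) => [|x _]; last first.
  by congr (_ + _ - _)%N; apply: cGl.
rewrite [X in (_ + X)%N](eq_bigr (fun=> dl)) => [|x _]; last first.
  by congr (_ + _ - _)%N; apply: cGr.
have inGl x : (p \in G (inl x)) = (x.1 * m <= p < x.1 * m + m)%N by rewrite inE.
have inGr w : (p \in G (inr w)) = (l * m <= p)%N by rewrite inE ltn_ord andbT.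
rewrite (eq_bigl _ _ inGl) (eq_bigl _ _ inGr).
have [pl|pl] := ltnP p (l * m).
  rewrite [X in (_ + X)%N]big_pred0 ?addn0 => [|_//].
  have m_gt0 : (0 < m)%N by case: (m) pl => //; rewrite muln0.
  have gl : (p %/ m < l)%N by rewrite ltn_divLR.
  (* The only small group containing [p] is the one numbered [p %/ m]. *)
  rewrite (eq_bigl (mem (finset.setX [set Ordinal gl] [set: 'I_dl]))).
    by rewrite sum_nat_const cardsX cards1 cardsT card_ord mul1n.
  move=> [g w]; rewrite !inE andbT -[RHS]/(g == (p %/ m)%N :> nat) /=.
  by rewrite -leq_divRL// -mulSnr -ltn_divLR// ltnS eqn_leq.
rewrite big_pred0 ?add0n => [|[g w]/=].
  by rewrite sum_nat_const card_ord mulnC.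
apply/negP => /andP[_].
have : (g.+1 * m <= l * m)%N by rewrite leq_mul2r ltn_ord orbT.
by lia.
Qed.

(** * File size, node size and bandwidth of the resulting code *)

Theorem theorem6p2 (R : realType) (n k d l : nat) (alpha : R) :
  (0 < k)%N -> (k <= d)%N -> (d < n)%N -> 0 < alpha ->
  (1 <= l)%N -> (l <= n %/ (n + 1 - k))%N ->
  let m : R := (n %/ l)%:R in
  let k1 : R := m - n%:R + k%:R in
  let d1 : R := m - n%:R + d%:R in
  let kl : R := k%:R - (l%:R - 1) * m in
  let dl : R := d%:R - (l%:R - 1) * m in
  ((((l%:R - 1) * k1 + kl * d1 / dl) * alpha)%:E
     <= C_exact n k d alpha (d1 * alpha / (d%:R - k%:R + 1)))%E.
Proof.
(* From here on [l] stands for the [l - 1] of the statement. *)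
move=> k_gt0 kd dn alpha_gt0; case: l => [//|l] _ le_l.
set m0 := (n %/ l.+1)%N; cbv zeta.
have lmn : (l * m0 + m0 <= n)%N.
  by rewrite addnC -mulSn mulnC leq_divM.
have mnk : (n + 1 - k <= m0)%N.
  rewrite leq_divRL// mulnC; rewrite leq_divRL in le_l => //; lia.
(* These bounds make the truncated differences agree with those in [R]. *)
have nD1 : (n <= m0 + d)%N by lia.
have nDL : (n <= n - l * m0 + d)%N by lia.
have lm_n : (l * m0 <= n)%N by lia.
have kn : (k <= n)%N by lia.
have D1E : (m0 + d - n)%N%:R = m0%:R - n%:R + d%:R :> R.
  by rewrite natrB// natrD; ring.
have DLE : (n - l * m0 + d - n)%N%:R = d%:R - l%:R * m0%:R :> R.
  by rewrite natrB// natrD natrB// natrM; ring.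
have [C [G [cC sumG leG sumw]]] := @node_grouping n d l m0 lmn dn.
set D1 := (m0 + d - n)%N in cC sumG sumw D1E.
set DL := (n - l * m0 + d - n)%N in cC sumG sumw DLE.
have D1_gt0 : (0 < D1)%N by rewrite /D1; lia.
have DL_gt0 : (0 < DL)%N by rewrite /DL; lia.
(* Every block at [p] has weight at least [D1], and these weights add up to [DL * D1]. *)
have degG p : (#|[set c | p \in G c]| <= DL)%N.
  rewrite -(leq_pmul2r D1_gt0) -(sumw p) -sum_nat_const.
  rewrite (eq_bigl (fun c => p \in G c)) => [|c]; last by rewrite inE.
  by apply: leq_sum => c _; have := leG c; rewrite /D1; lia.
clearbody D1 DL.
pose B : finType := ('S_n * C)%type.
pose GB (b : B) : {set 'I_n} := b.1 @^-1: G b.2.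
have degB i : (#|[set b | i \in GB b]| <= n`! * DL)%N.
  rewrite -sum1_card (eq_bigl (fun b : B => xpredT b.1 && (b.1 i \in G b.2))).
    rewrite -(pair_big_dep xpredT (fun (s : 'S_n) c => s i \in G c)
      (fun _ _ => 1%N)) /= -card_Sn -sum_nat_const.
    apply: leq_sum => s _; apply: leq_trans (degG (s i)).
    by rewrite -[leqRHS]sum1_card; apply: eq_leq; apply: eq_bigl => c; rewrite inE.
  by move=> b; rewrite !inE.
have d_gt0 : (0 < d)%N by apply: leq_trans kd.
have [q [M [S [T [store [q_gt1 dss cM cS cT]]]]]] :=
  @block_dss n k d _ _ B GB kd dn degB (@balanced_helpers n d _ C G d_gt0 sumw).
have sumGB : (\sum_b #|GB b| = n`! * \sum_c #|G c|)%N.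
  rewrite -card_Sn -sum_nat_const pair_big /=; apply: eq_bigr => b _.
  by rewrite card_preimset//; apply: perm_inj.
set L : R := ln q%:R.
have q_gt0 : 0 < q%:R :> R by rewrite ltr0n ltnW.
have lnq e : ln ((q ^ e)%N%:R) = e%:R * L by rewrite natrX lnXn// mulr_natl.
have L_gt0 : 0 < L by rewrite ln_gt0// ltr1n.
pose N := n`!; pose s := (d - k).+1.
have N_gt0 : (0 < N)%N by exact: fact_gt0.
have sE : s%:R = d%:R - k%:R + 1 :> R by rewrite /s -addn1 natrD natrB.
have s_gt0 : 0 < s%:R :> R by rewrite ltr0n.
have l1E : l.+1%:R - 1 = l%:R :> R by rewrite -addn1 natrD addrK.
have DL0 : DL%:R != 0 :> R by rewrite pnatr_eq0 -lt0n.
rewrite l1E -D1E -DLE -sE.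
apply: ereal_sup_ubound => /=; exists
  ((l%:R * (m0%:R - n%:R + k%:R) + (k%:R - l%:R * m0%:R) * D1%:R / DL%:R) * alpha) => //.
have sn : (s ^ n = s * s ^ n.-1)%N by rewrite -expnS prednK// (leq_trans _ dn).
(* A node holds [s ^ n * N * DL] symbols of [L] nats each; this scale makes its size exactly
   [alpha]. *)
exists M, S, T, store, ((s ^ n)%N%:R * N%:R * DL%:R * L / alpha).
have M_gt0 : (0 < #|M|)%N.
  move: cM; case: #|M| => //; rewrite mul0n leqn0 expn_eq0.
  by rewrite -leqn0 leqNgt (ltnW q_gt1).
split; first by rewrite divr_gt0// !mulr_gt0// ltr0n// expn_gt0.
split; first exact: dss.
split; [|split].
(* Symbols minus checks, divided by [s ^ n * N], give [l * DL * (m0 - n + k) + D1 * (k - l *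
   m0)]. *)
- have : ln ((q ^ (s ^ n * \sum_b #|GB b|))%N%:R : R) <=
      ln (#|M| * q ^ (s ^ n * (#|B| * (n - k))))%N%:R.
    by rewrite ler_ln ?ler_nat ?posrE ?ltr0n ?muln_gt0 ?M_gt0 ?expn_gt0 ?(ltnW q_gt1).
  rewrite natrM lnM ?posrE ?ltr0n ?expn_gt0 ?(ltnW q_gt1)// !lnq.
  rewrite -lerBlDr sumGB sumG card_prod card_Sn cC -/N !natrM !natrD !natrM.
  rewrite !natrB// natrM.
  apply: le_trans; rewrite le_eqVlt; apply/orP; left; apply/eqP.
  by field; rewrite DL0 gt_eqF.
- rewrite cS lnq !natrM le_eqVlt; apply/orP; left; apply/eqP.
  by field; rewrite gt_eqF.
- rewrite cT lnq natrM -/N -/s.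
  (* Rounding the load down is harmless, since only an upper bound on the bandwidth is required. *)
  have h : (N * (DL * D1) %/ d)%N%:R <= N%:R * (DL%:R * D1%:R) / d%:R :> R.
    by rewrite ler_pdivlMr ?ltr0n// -!natrM ler_nat leq_divM.
  apply: le_trans (_ : (s ^ n.-1)%N%:R * (N%:R * (DL%:R * D1%:R) / d%:R) * L <= _).
    by rewrite ler_wpM2r ?ler_wpM2l// ltW.
  rewrite sn natrM le_eqVlt; apply/orP; left; apply/eqP.
  by field; rewrite !gt_eqF// ltr0n.
Qed.
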